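(* For any class $\mathcal{K}\subseteq\Omega$ of Boolean functions the following conditions are equivalent: (1) $\mathcal{K}\in\mathbf{I}(W^{\infty})$; (2) $\rightarrow\ \in\mathcal{K}\subseteq W^{\infty}$, and $\mathcal{K}$ is an equational class satisfying $Z_{\infty}\mathcal{K}=\mathcal{K}$; (3) $\rightarrow\ \in\mathcal{K}\subseteq W^{\infty}$, and $\mathcal{K}$ is an ideal with respect to the quasiorder $\sqsubseteq$.
   Context: $\Omega$ is the set of all Boolean functions $f\colon\{0,1\}^n\to\{0,1\}$, $n\ge 1$. An $m$-ary $g$ is a subfunction of an $n$-ary $f$, written $g\preceq f$, if there is a map $\sigma\colon\{1,\dots,n\}\to\{1,\dots,m\}$ with $g(x_1,\dots,x_m)=f(x_{\sigma(1)},\dots,x_{\sigma(n)})$ identically. An equational class is a set $\mathcal{K}\subseteq\Omega$ (possibly empty) such that $f\in\mathcal{K}$ and $g\preceq f$ imply $g\in\mathcal{K}$. For an $n$-ary $f$ and $k$-ary $g_1,\dots,g_n$, the composition $f(g_1,\dots,g_n)$ is the $k$-ary function $\mathbf{a}\mapsto f(g_1(\mathbf{a}),\dots,g_n(\mathbf{a}))$; $\mathcal{K}$ is composition-closed if all compositions $f(g_1,\dots,g_n)$ with $f,g_1,\dots,g_n\in\mathcal{K}$ ($g_i$ of equal arity) belong to $\mathcal{K}$. A clone is a composition-closed subset of $\Omega$ containing all projections; $[\mathcal{K}]$ is the smallest clone containing $\mathcal{K}$. $\mathbf{I}$ is the set of all composition-closed equational classes, and $\mathbf{I}(\mathcal{C})=\{\mathcal{K}\in\mathbf{I}:[\mathcal{K}]=\mathcal{C}\}$.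 An $n$-ary $f$ preserves a relation $P\subseteq\{0,1\}^k$ if applying $f$ coordinatewise to any $n$ members of $P$ gives a member of $P$. For finite $k\ge2$, $W^k$ is the clone of functions preserving $\{0,1\}^k\setminus\{\mathbf{0}\}$, where $\mathbf{0}=(0,\dots,0)$; $W^\infty=\bigcap_{k\ge2}W^k$, which is the clone generated by implication. $\rightarrow$ is the binary implication $x\to y$. For $n$-ary $f$, $f^{-1}(0)=\{\mathbf{a}\in\{0,1\}^n:f(\mathbf{a})=0\}$. $Z_\infty\mathcal{K}$ is the set of all $f\in\Omega$ for which there is $g\in\mathcal{K}$ of the same arity as $f$ with $f^{-1}(0)\subseteq g^{-1}(0)$. Let $\leq$ be the usual pointwise order on Boolean functions (of the same arity), $\geq$ its converse; $\sqsubseteq$ is the transitive closure of the relation $\preceq\cup\geq$ on $\Omega$. $\mathcal{K}$ is an ideal with respect to $\sqsubseteq$ if $f\in\mathcal{K}$ and $g\sqsubseteq f$ imply $g\in\mathcal{K}$ (downward closed). *)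

(* Defs.v *)
From Stdlib Require Import Relation_Operators.
From mathcomp Require Import all_boot classical_sets.

Set Implicit Arguments.
Unset Strict Implicit.
Unset Printing Implicit Defensive.

Local Open Scope classical_set_scope.

(* {0,1}^k is [bool ^ k = {ffun 'I_k -> bool}], so that functions on it are
   extensional; 0 is [false] and 1 is [true]. *)
Definition bfun (n : nat) : Type := {ffun bool ^ n -> bool}.

(* Arities are at least 1: the first component is the arity minus one. *)
Definition Omega : Type := {n : nat & bfun n.+1}.

Definition omega (n : nat) (f : bfun n.+1) : Omega :=
  existT (fun k => bfun k.+1) n f.

Definition arity (f : Omega) : nat := (projT1 f).+1.

Definition fn (f : Omega) : bfun (arity f) := projT2 f.

(* [subfun g f] is g \preceq f *)
Definition subfun (g f : Omega) : Prop :=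
  exists sigma : 'I_(arity f) -> 'I_(arity g),
    forall x : bool ^ arity g, fn g x = fn f [ffun i => x (sigma i)].

Definition equational_class (K : set Omega) : Prop :=
  forall f g : Omega, K f -> subfun g f -> K g.

Definition compose (n k : nat) (f : bfun n) (g : 'I_n -> bfun k) : bfun k :=
  [ffun a : bool ^ k => f [ffun i => g i a]].

Definition composition_closed (K : set Omega) : Prop :=
  forall (n k : nat) (f : bfun n.+1) (g : 'I_n.+1 -> bfun k.+1),
    K (omega f) -> (forall i, K (omega (g i))) -> K (omega (compose f g)).

Definition projection (n : nat) (i : 'I_n) : bfun n := [ffun x : bool ^ n => x i].

Definition clone (C : set Omega) : Prop :=
  composition_closed C /\
  forall (n : nat) (i : 'I_n.+1), C (omega (projection i)).

Definition clone_generated (K : set Omega) : set Omega := smallest clone K.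

Definition II : set (set Omega) :=
  [set K | composition_closed K /\ equational_class K].

Definition II_of (C : set Omega) : set (set Omega) :=
  [set K | II K /\ clone_generated K = C].

Definition preserves (n k : nat) (f : bfun n) (P : set (bool ^ k)) : Prop :=
  forall a : 'I_n -> bool ^ k,
    (forall i, P (a i)) -> P [ffun j => f [ffun i => a i j]].

Definition W (k : nat) : set Omega :=
  [set f | preserves (fn f) (~` [set [ffun=> false] : bool ^ k])].

Definition Winfty : set Omega := \bigcap_(k in [set k : nat | 2 <= k]) W k.

Definition implication : bfun 2 :=
  [ffun x : bool ^ 2 => x ord0 ==> x ord_max].

Definition zeros (n : nat) (f : bfun n) : set (bool ^ n) := f @^-1` [set false].

Definition Zinfty (K : set Omega) : set Omega :=
  [set f : Omega | exists2 g : bfun (arity f),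
     K (omega g) & zeros (fn f) `<=` zeros g].

(* The order on values is that of [nat], through the coercion of [bool]. *)
Definition pointwise_le (f g : Omega) : Prop :=
  exists (n : nat) (f' g' : bfun n.+1),
    [/\ f = omega f', g = omega g' & forall x, f' x <= g' x].

(* [sqsubseteq g f] is g \sqsubseteq f *)
Definition sqsubseteq : Omega -> Omega -> Prop :=
  clos_trans Omega (fun g f => subfun g f \/ pointwise_le f g).

Definition ideal (K : set Omega) : Prop :=
  forall f g : Omega, K f -> sqsubseteq g f -> K g.

(* Main.v *)
Require Import Defs.
From mathcomp Require Import all_boot classical_sets.
Local Open Scope classical_set_scope.

(** A function lies in [Winfty] exactly when it lies above one of its
    variables, [x i <= f x].  Granted this, the passage from ideals to
    [II_of Winfty] is immediate: if [f] is above its [i]-th variable then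
    [f(g_1, ..., g_n)] is above [g_i], so that an upward closed class inside
    [Winfty] is composition-closed ([Winfty_upclosed_composition]).

    Conversely, let [K] be a composition-closed equational class generating
    [Winfty].  To see that [K] contains implication, note that if some member
    vanishes at the zero tuple, identifying its variables gives the identity;
    then [K] is a clone, namely [Winfty] itself.  If not, a member with a zero
    [a] becomes implication when its variables are identified according to
    [a].  And if no member has a zero, [K] only generates monotone functions.

    To see that [K] is upward closed, use that [K] is closed under pointwise
    implication.  The functions [h] such that [u || h] is in [K] for all [u] in
    [K] include the members of [K] and the constant 0, and they are closed
    under implication; hence they are closed under all Boolean operations
    ([join_closure]).  Let now [f] be in [K], above its [i]-th variable, and
    let [g >= f].  The functions [x_j -> x_i] belong to [K], and on the zeros
    of [f], where [x_i = 0], they are the negations of the variables.  So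
    [g = f || Q(x_1 -> x_i, ..., x_n -> x_i)], where [Q z = g (~~ z)], is in
    [K].  The same closure property, applied to projections, shows that
    implication generates [Winfty]. *)

(** * Boolean closure under implication *)

Definition implf {X : finType} (u v : {ffun X -> bool}) : {ffun X -> bool} :=
  [ffun x => u x ==> v x].

Definition implication_closed {X : finType} (S : {ffun X -> bool} -> Prop) :=
  forall u v, S u -> S v -> S (implf u v).

(** Implication and 0 form a complete set of connectives; the composite is
    assembled from them through its disjunctive normal form. *)
Lemma boolean_closure {X : finType} {T : {ffun X -> bool} -> Prop} {n : nat}
    (Q : bfun n) (g : 'I_n -> {ffun X -> bool}) :
  T [ffun=> false] -> implication_closed T -> (forall i, T (g i)) ->
  T [ffun x => Q [ffun i => g i x]].
Proof.
move=> T0 Timp Tg.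
have Tneg h : T h -> T [ffun x => ~~ h x].
  move=> Th; suff -> : [ffun x => ~~ h x] = implf h [ffun=> false].
    exact: Timp.
  by apply/ffunP => x; rewrite !ffunE implybF.
have Tor u v : T u -> T v -> T [ffun x => u x || v x].
  move=> Tu Tv.
  suff -> : [ffun x => u x || v x] = implf [ffun x => ~~ u x] v.
    by apply/Timp => //; exact: Tneg.
  by apply/ffunP => x; rewrite !ffunE implyNb.
have Tand u v : T u -> T v -> T [ffun x => u x && v x].
  move=> Tu Tv.
  suff -> : [ffun x => u x && v x]
      = [ffun x => ~~ implf u [ffun x => ~~ v x] x].
    by apply/Tneg/Timp => //; exact: Tneg.
  by apply/ffunP => x; rewrite !ffunE; case: (u x); case: (v x).
have Tminterm (b : bool ^ n) : T [ffun x => [forall i, g i x == b i]].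
  suff [h Th hE] : exists2 h, T h &
      forall x, h x = \big[andb/true]_(i < n) (g i x == b i).
    suff <- : h = [ffun x => [forall i, g i x == b i]] by [].
    by apply/ffunP => x; rewrite hE ffunE big_andE.
  elim: (index_enum _) => [|i s [h Th hE]].
    exists [ffun x => ~~ [ffun=> false] x]; first exact: Tneg.
    by move=> x; rewrite !ffunE big_nil.
  exists [ffun x => [ffun x => g i x == b i] x && h x]; last first.
    by move=> x; rewrite !ffunE big_cons hE.
  apply: Tand => //; case: (b i).
    suff -> : [ffun x => g i x == true] = g i by [].
    by apply/ffunP => x; rewrite ffunE eqb_id.
  suff -> : [ffun x => g i x == false] = [ffun x => ~~ g i x] by exact: Tneg.
  by apply/ffunP => x; rewrite !ffunE eqbF_neg.
suff [h Th hE] : exists2 h, T h &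
    forall x, h x = \big[orb/false]_(b | Q b) [forall i, g i x == b i].
  suff <- : h = [ffun x => Q [ffun i => g i x]] by [].
  apply/ffunP => x; rewrite hE ffunE big_orE; apply/existsP/idP.
    case=> b /andP[Qb /forallP gb].
    suff -> : [ffun i => g i x] = b by [].
    by apply/ffunP => i; rewrite ffunE; apply/eqP.
  move=> Qg; exists [ffun i => g i x]; rewrite Qg /=.
  by apply/forallP => i; rewrite ffunE.
elim: (index_enum _) => [|b s [h Th hE]].
  by exists [ffun=> false] => // x; rewrite ffunE big_nil.
case Qb: (Q b); last by exists h => // x; rewrite big_cons Qb.
exists [ffun x => [ffun x => [forall i, g i x == b i]] x || h x].
  exact: Tor.
by move=> x; rewrite !ffunE big_cons Qb hE.
Qed.

(** The functions [h] with [u || h] in [S] for all [u] in [S] satisfy the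
    hypotheses of [boolean_closure], because [u || (h -> h')] is
    [(u || h) -> (u || h')], and they include [S], because [u || v] is
    [(u -> v) -> v]. *)
Lemma join_closure {X : finType} {S : {ffun X -> bool} -> Prop} {n : nat}
    (Q : bfun n) (g : 'I_n -> {ffun X -> bool}) (u : {ffun X -> bool}) :
  implication_closed S -> (forall i, S (g i)) -> S u ->
  S [ffun x => u x || Q [ffun i => g i x]].
Proof.
move=> Simp Sg Su.
pose T h := forall w, S w -> S [ffun x => w x || h x].
suff /(_ u Su) : T [ffun x => Q [ffun i => g i x]].
  by congr S; apply/ffunP => x; rewrite !ffunE.
apply: (@boolean_closure X T).
- move=> w Sw; suff -> : [ffun x => w x || [ffun=> false] x] = w by [].
  by apply/ffunP => x; rewrite !ffunE orbF.
- move=> h h' Th Th' w Sw; move: (Simp _ _ (Th w Sw) (Th' w Sw)); congr S.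
  by apply/ffunP => x; rewrite !ffunE; case: (w x).
- move=> i w Sw; move: (Simp _ _ (Simp _ _ Sw (Sg i)) (Sg i)); congr S.
  by apply/ffunP => x; rewrite !ffunE; case: (w x); case: (g i x).
Qed.

(** * The clone of functions above a variable *)

(** If for each variable [i] some zero [x] of [f] had [x i = 1], the matrix
    having these zeros as rows would have nonzero columns, yet [f] maps it to
    0. *)
Lemma WinftyP (n : nat) (f : bfun n.+1) :
  Winfty (omega f) <-> exists i, forall x : bool ^ n.+1, x i -> f x.
Proof.
split=> [Wf|[i fi] k _ a aP /ffunP fa].
  case: (boolP [exists i, [forall x : bool ^ n.+1, x i ==> f x]]).
    by case/existsP => i /forallP fi; exists i => x; apply/implyP.
  move/existsPn => nof.
  have zeroP i : exists x : bool ^ n.+1, x i && ~~ f x.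
    have /forallPn[x] := nof i.
    by rewrite negb_imply => xP; exists x.
  have [z zP] := fin_all_exists zeroP.
  (* [W k] requires [2 <= k], while [f] may be unary: with [n.+2] rows, the
     last row repeats an earlier one. *)
  pose a (i : 'I_n.+1) : bool ^ n.+2 := [ffun j : 'I_n.+2 => z (inord j) i].
  have := Wf n.+2 isT a; case.
    move=> i /ffunP /(_ (widen_ord (leqnSn n.+1) i)).
    by rewrite !ffunE /= inord_val; case/andP: (zP i) => ->.
  apply/ffunP => j; rewrite !ffunE /=.
  case/andP: (zP (inord j)) => _ /negbTE <-; congr (f _).
  by apply/ffunP => i; rewrite !ffunE.
apply: (aP i); apply/ffunP => j; move: (fa j); rewrite !ffunE => faj.
apply/negbTE/negP => aij.
by move: faj; rewrite fi // ffunE.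
Qed.

Lemma Winfty_clone : clone Winfty.
Proof.
split=> [n k f g /WinftyP[i fi] Wg|n i]; last first.
  by apply/WinftyP; exists i => x; rewrite ffunE.
have /WinftyP[j gj] := Wg i.
by apply/WinftyP; exists j => x /gj gx; rewrite ffunE fi // ffunE.
Qed.

Lemma composition_implication_closed {K : set Omega} {n : nat} :
  K (omega implication) -> composition_closed K ->
  implication_closed (fun u : bfun n.+1 => K (omega u)).
Proof.
move=> Kimp Kcomp u v Ku Kv.
have := Kcomp _ _ implication (fun i => if i == ord0 then u else v) Kimp.
suff -> : compose implication (fun i => if i == ord0 then u else v)
    = implf u v.
  by apply=> i; case: ifP.
by apply/ffunP => x; rewrite !ffunE.
Qed.

(** Writing [f] as [x_i || f], [join_closure] builds it from projections. *)
Lemma Winfty_sub_clone (C : set Omega) :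
  clone C -> C (omega implication) -> Winfty `<=` C.
Proof.
move=> [Ccomp Cproj] Cimp [n f] /WinftyP[i fi].
have := join_closure f (@projection n.+1) (projection i)
  (composition_implication_closed Cimp Ccomp) (Cproj n) (Cproj n i).
congr (C (omega _)); apply/ffunP => x.
rewrite ffunE (_ : [ffun j => projection j x] = x); last first.
  by apply/ffunP => j; rewrite !ffunE.
by rewrite ffunE; case xi: (x i) => //=; rewrite fi.
Qed.

(** * Upward closed classes *)

Definition upclosed (K : set Omega) : Prop :=
  forall (n : nat) (f g : bfun n.+1),
    K (omega f) -> (forall x, f x -> g x) -> K (omega g).

Lemma upclosed_Zinfty (K : set Omega) : upclosed K <-> Zinfty K = K.
Proof.
split=> [Kup|ZK n f g Kf fg].
  apply/seteqP; split=> [[n f] [g Kg fg]|[n f] Kf]; last by exists f.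
  apply: (Kup n g f Kg) => x gx; apply/negPn/negP => /negbTE fx.
  by have := fg x fx; rewrite /zeros /= gx.
rewrite -ZK; exists f => // x; rewrite /zeros /= => gx.
by apply/negP => /fg; rewrite gx.
Qed.

Lemma upclosed_ideal (K : set Omega) :
  equational_class K /\ upclosed K <-> ideal K.
Proof.
split=> [[Keq Kup] f g Kf gf|Kid].
  elim: gf Kf => {f g} [g f|h g f _ Khg _ Kgf /Kgf/Khg //].
  case=> [gf Kf|[n [f' [g' [-> -> fg]]]] Kf]; first exact: Keq gf.
  by apply: (Kup _ f' g') => // x f'x; move: (fg x); rewrite f'x; case: (g' x).
split=> [f g Kf gf|n f g Kf fg].
  by apply: Kid Kf _; apply: Relation_Operators.t_step; left.
apply: Kid Kf _; apply: Relation_Operators.t_step; right.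
exists n, f, g; split=> // x.
by move: (fg x); case: (f x) => // ->.
Qed.

Lemma Winfty_upclosed_composition (K : set Omega) :
  K `<=` Winfty -> upclosed K -> composition_closed K.
Proof.
move=> KW Kup n k f g Kf Kg; have /WinftyP[i fi] := KW _ Kf.
by apply: (Kup _ _ _ (Kg i)) => x gx; rewrite ffunE fi // ffunE.
Qed.

(** * Classes generating the clone of implication *)

Definition monotone : set Omega :=
  [set f | forall x y : bool ^ arity f,
             (forall i, x i -> y i) -> fn f x -> fn f y].

Lemma monotone_clone : clone monotone.
Proof.
split=> [n k f g Mf Mg x y xy|n i x y xy]; rewrite /= !ffunE; last exact: xy.
by apply: Mf => i; rewrite !ffunE; apply: (Mg i).
Qed.

(** Being above a variable, [f] is 1 at the all-one tuple, so identifying all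
    of its variables leaves the identity; dummy variables do the rest. *)
Lemma projections_of_zero {K : set Omega} {n : nat} {f : bfun n.+1} :
  K `<=` Winfty -> equational_class K -> K (omega f) ->
  f [ffun=> false] = false ->
  forall m (i : 'I_m.+1), K (omega (projection i)).
Proof.
move=> KW Keq Kf f0 m i; have /WinftyP[j fj] := KW _ Kf.
apply: Keq Kf _; exists (fun=> i) => /= x.
rewrite ffunE; case xi: (x i); first by rewrite fj // ffunE.
by rewrite -[LHS]f0; congr (f _); apply/ffunP => l; rewrite !ffunE xi.
Qed.

(** The variables at which the zero [a] is 1 become the premise, the others
    the conclusion. *)
Lemma implication_of_zero {K : set Omega} {n : nat} {f : bfun n.+1}
    {a : bool ^ n.+1} :
  K `<=` Winfty -> equational_class K -> K (omega f) ->
  f [ffun=> false] -> f a = false -> K (omega implication).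
Proof.
move=> KW Keq Kf f0 fa; have /WinftyP[j fj] := KW _ Kf.
apply: Keq Kf _.
exists (fun i => if a i then ord0 else ord_max) => /= x.
have aj : a j = false by apply/negP => /fj; rewrite fa.
rewrite ffunE; case x1: (x ord_max); first by rewrite implybT fj // ffunE aj.
case x0: (x ord0) => /=.
  rewrite -[LHS]fa; congr (f _); apply/ffunP => i; rewrite ffunE.
  by case: (a i).
rewrite -[LHS]f0; congr (f _); apply/ffunP => i; rewrite !ffunE.
by case: ifP; rewrite ?x0 ?x1.
Qed.

Lemma Winfty_implication : Winfty (omega implication).
Proof. by apply/WinftyP; exists ord_max => x x1; rewrite ffunE x1 implybT. Qed.

Lemma generating_sub {K : set Omega} : II_of Winfty K -> K `<=` Winfty.
Proof. by case=> _ <-; apply: sub_smallest. Qed.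

Lemma generating_implication {K : set Omega} :
  II_of Winfty K -> K (omega implication).
Proof.
move=> IK; have KW := generating_sub IK; case: IK => [[Kcomp Keq] Kgen].
have [//|nKimp] := boolp.pselect (K (omega implication)).
(* [clone_generated K] contains implication, so every clone above [K] does. *)
have genP C : clone C -> K `<=` C -> C (omega implication).
  move=> cloneC KC; have := Winfty_implication; rewrite -Kgen; apply.
  by split.
have K1 (n : nat) (f : bfun n.+1) (x : bool ^ n.+1) : K (omega f) -> f x.
  move=> Kf; case f0: (f [ffun=> false]).
    case fx: (f x) => //; exfalso; apply: nKimp.
    exact: implication_of_zero KW Keq Kf f0 fx.
  exfalso; apply: nKimp; apply: genP => //; split=> //.
  exact: projections_of_zero KW Keq Kf f0.
have Kmon : K `<=` monotone.
  by move=> [n f] Kf x y _ _; exact: K1.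
have Mimp := genP _ monotone_clone Kmon.
have : implication [ffun i => i == ord0].
  by apply: (Mimp [ffun=> false]) => [i|]; rewrite !ffunE.
by rewrite !ffunE.
Qed.

Lemma generating_upclosed {K : set Omega} : II_of Winfty K -> upclosed K.
Proof.
move=> IK n f g Kf fg.
have Kimp := generating_implication IK; have KW := generating_sub IK.
case: IK => [[Kcomp Keq] _]; have /WinftyP[i fi] := KW _ Kf.
pose z (j : 'I_n.+1) : bfun n.+1 := [ffun x : bool ^ n.+1 => x j ==> x i].
have Kz j : K (omega (z j)).
  apply: Keq Kimp _; exists (fun l => if l == ord0 then j else i) => /= x.
  by rewrite !ffunE.
pose Q : bfun n.+1 := [ffun b : bool ^ n.+1 => g [ffun j => ~~ b j]].
have := join_closure Q z f
  (composition_implication_closed Kimp Kcomp) Kz Kf.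
congr (K (omega _)); apply/ffunP => x; rewrite !ffunE.
case fx: (f x) => /=; first by rewrite fg.
have xi : x i = false by apply/negP => /fi; rewrite fx.
by congr (g _); apply/ffunP => j; rewrite !ffunE xi implybF negbK.
Qed.

Lemma generating_iff_upclosed (K : set Omega) :
  II_of Winfty K <->
  [/\ K (omega implication), K `<=` Winfty, equational_class K & upclosed K].
Proof.
split=> [IK|[Kimp KW Keq Kup]].
  split; [exact: generating_implication|exact: generating_sub| |
          exact: generating_upclosed].
  by case: IK => [[]].
split; first by split=> //; exact: Winfty_upclosed_composition.
apply/seteqP; split.
  by apply: smallest_sub => //; exact: Winfty_clone.
by move=> f Wf C [cloneC KC]; apply: Winfty_sub_clone Wf => //; exact: KC.
Qed.

Theorem theorem5p5 (K : set Omega) :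
  (II_of Winfty K <->
     [/\ K (omega implication), K `<=` Winfty, equational_class K
       & Zinfty K = K]) /\
  (II_of Winfty K <->
     [/\ K (omega implication), K `<=` Winfty & ideal K]).
Proof.
split; apply: (iff_trans (generating_iff_upclosed K)).
  by split=> -[Kimp KW Keq] /upclosed_Zinfty.
split=> [[Kimp KW Keq Kup]|[Kimp KW /upclosed_ideal[Keq Kup]]] //.
by split=> //; apply/upclosed_ideal.
Qed.
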